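(* Under information regulation, the Expected-Vickrey Auction is dominant-strategy IIC and IR, and it achieves maximum welfare: under truthful behavior the item goes, at every type profile $\boldsymbol t$ and fully revealed information profile $\boldsymbol\sigma$, to a bidder attaining $\max_i v_i(t_i;\sigma_i)$.
   Context: Setting. A single item is auctioned to $n$ bidders. Bidder $i$ has a (possibly infinite) type set $T_i$, a finite state set $\Theta_i$ and a value function $v_i:T_i\times\Theta_i\to\mathbb{R}$. Write $\Theta=\prod_i\Theta_i$ and $\Delta(X)$ for the probability distributions on $X$. The state profile $\boldsymbol\theta$ is drawn from a prior $g\in\Delta(\Theta)$ with marginals $g_i$ (states may be correlated). Types $t_i\sim h_i$ are independent across bidders and independent of states and signals. An experiment of bidder $i$ is $\tau_i\in\Delta(\Delta(\Theta_i))$ with mean $g_i$; its outcome $\sigma_i\in\Delta(\Theta_i)$ is the posterior belief on $\theta_i$, i.e. $\Pr(\theta_i\mid\sigma_i)=\sigma_i(\theta_i)$. Write $\tau_i\geq_{\mathrm{MPS}}\lambda_i$ if $\sigma_i\sim\tau_i$ and $s_i\sim\lambda_i$ can be coupled so that $\mathbf{E}[\sigma_i\mid s_i]=s_i$. Bidder $i$ privately observes $t_i$ and $\sigma_i\sim\tau_i$ (not $\theta_i$). Standing assumption: $\theta_i\perp\sigma_j\mid\sigma_i$ for all $i\neq j$. Bidder $i$ acts by reporting $b_i\in T_i$ and committing to an experiment $\lambda_i$ with $\tau_i\geq_{\mathrm{MPS}}\lambda_i$ ($\lambda_i=\tau_i$ is full revelation); the auctioneer sees $\boldsymbol b$ and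 $\boldsymbol s=(s_1,\dots,s_n)$, $s_i\sim\lambda_i$. Given $\boldsymbol\theta$, signals are independent across bidders, so $\boldsymbol s$ has joint distribution $\boldsymbol\lambda(\boldsymbol s)=\sum_{\boldsymbol\theta}g(\boldsymbol\theta)\prod_i s_i(\theta_i)\lambda_i(s_i)/g_i(\theta_i)$; $s_{-i}\sim\lambda_{-i}$ refers to its marginal. Write $v_i(b_i;s_i)=\sum_{\theta_i}s_i(\theta_i)v_i(b_i;\theta_i)$. Information regulation. The auctioneer commits to estimate each bidder $i$'s state with only his own signal: given $(s_i,s_{-i})$, her belief on $\theta_i$ is $\Pr(\theta_i\mid s_i)=s_i(\theta_i)$. Expected-Vickrey Auction under information regulation. On input $(\boldsymbol b,\boldsymbol s)$ the item is allocated to the bidder $i=\arg\max_j v_j(b_j;s_j)$ (ties broken by a fixed rule), who pays $\max_{j\neq i}v_j(b_j;s_j)$; all others get and pay nothing. Truthfulness under information regulation. With true type $t_i$, bidder $i$'s expected utility is $$\bar{\mathtt U}_i^R(b_i,b_{-i};\lambda_i,\lambda_{-i})=\mathbf{E}_{s_{-i}\sim\lambda_{-i}}\mathbf{E}_{s_i\sim\lambda_i}\big[x_i(\boldsymbol b;s_i,s_{-i})\,v_i(t_i;s_i)-p_i(\boldsymbol b;s_i,s_{-i})\big].$$ Dominant-strategy IIC: $\bar{\mathtt U}_i^R(t_i,b_{-i};\tau_i,\lambda_{-i})\ge\bar{\mathtt U}_i^R(b_i,b_{-i};\lambda_i,\lambda_{-i})$ for every $i$, all $t_i,b_i\in T_i$,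 all $\lambda_i$ with $\tau_i\geq_{\mathrm{MPS}}\lambda_i$, all $b_{-i}\in T_{-i}$ and all $\lambda_{-i}$ with $\tau_j\geq_{\mathrm{MPS}}\lambda_j$ for $j\ne i$. IR: $x_i(\boldsymbol t;\boldsymbol\sigma)v_i(t_i;\sigma_i)-p_i(\boldsymbol t;\boldsymbol\sigma)\ge0$ for every $i$, every truthful type profile $\boldsymbol t$ and every fully revealing signal profile $\boldsymbol\sigma$. ''Maximum welfare'' is with respect to expected values given $(\boldsymbol t,\boldsymbol\sigma)$; the maximum achievable welfare given $(\boldsymbol t,\boldsymbol\sigma)$ is $\max_i v_i(t_i;\sigma_i)$. *)

(* Defs.v *)
From HB Require Import structures.
From mathcomp Require Import all_boot all_order all_algebra.
From mathcomp Require Import all_classical all_reals all_analysis.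
From mathcomp Require Import measurable_realfun.

Set Implicit Arguments.
Unset Strict Implicit.
Unset Printing Implicit Defensive.
Import Order.TTheory GRing.Theory Num.Theory.
Local Open Scope classical_set_scope.
Local Open Scope ring_scope.

(* A state set carries a probability distribution, hence is nonempty; the
   choice of [point] plays no role beyond witnessing this. *)
#[short(type="pointedFinType")]
HB.structure Definition PointedFinite := {X of isPointed X & Finite X}.

Section belief.
Context (R : realType).

Record belief (X : finType) := Belief {
  bweight :> {ffun X -> R};
  _ : [forall x, 0 <= bweight x] && (\sum_x bweight x == 1) }.

HB.instance Definition _ (X : finType) := [isSub for @bweight X].
HB.instance Definition _ (X : finType) := [Choice of belief X by <:].

Lemma belief_ge0 (X : finType) (s : belief X) x : 0 <= s x.
Proof. by case: s => s /= /andP[/forallP]. Qed.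

Lemma belief_sum (X : finType) (s : belief X) : \sum_x s x = 1.
Proof. by case: s => s /= /andP[_ /eqP]. Qed.

Section dirac_belief.
Context (X : pointedFinType).

Let point_weight : {ffun X -> R} := [ffun x => (x == point)%:R].

Fact point_weightP :
  [forall x, 0 <= point_weight x] && (\sum_x point_weight x == 1).
Proof.
apply/andP; split; first by apply/forallP => x; rewrite ffunE ler0n.
rewrite (bigD1 (point : X)) //= ffunE eqxx big1 ?addr0 //.
by move=> x /negbTE xp; rewrite ffunE xp.
Qed.

HB.instance Definition _ := isPointed.Build (belief X) (Belief point_weightP).

(* The trace on the simplex of the Borel sigma-algebra of R^X. *)
Definition belief_cylinders : set (set (belief X)) :=
  \bigcup_(x in [set: X])
    preimage_set_system [set: belief X] (fun s => s x) (@measurable _ R).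

HB.instance Definition _ :=
  @isMeasurable.Build (sigma_display belief_cylinders) (belief X)
    <<s belief_cylinders >> (@sigma_algebra0 _ setT _)
    (@sigma_algebraC _ belief_cylinders) (@sigma_algebra_bigcup _ setT _).

Lemma measurable_belief_ev (x : X) :
  measurable_fun [set: belief X] (fun s : belief X => s x).
Proof.
move=> _ B mB; apply: sub_gen_smallest.
by exists x => //; exists B.
Qed.

End dirac_belief.

End belief.

(* The product sigma-algebra on a finite dependent product, and the
   product of a family of probability measures on it. *)
Section dependent_product.
Context (n : nat) (d : 'I_n -> measure_display)
  (X : forall i, measurableType (d i)).

Definition dprod : Type := forall i, X i.

HB.instance Definition _ := Pointed.on dprod.

Definition dprod_cylinders : set (set dprod) :=
  \bigcup_(i in [set: 'I_n])
    preimage_set_system [set: dprod] (fun s => s i) (@measurable _ (X i)).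

HB.instance Definition _ :=
  @isMeasurable.Build (sigma_display dprod_cylinders) dprod
    <<s dprod_cylinders >> (@sigma_algebra0 _ setT _)
    (@sigma_algebraC _ dprod_cylinders) (@sigma_algebra_bigcup _ setT _).

Lemma measurable_dprod_proj i :
  measurable_fun [set: dprod] (fun s : dprod => s i).
Proof.
move=> _ B mB; apply: sub_gen_smallest.
by exists i => //; exists B.
Qed.

Lemma measurable_dprod d' (T : measurableType d') (f : T -> dprod) :
  (forall i, measurable_fun [set: T] (fun t => f t i)) ->
  measurable_fun [set: T] f.
Proof.
move=> mf.
apply: (@measurability _ _ T dprod setT f dprod_cylinders) => //.
move=> _ [_ [i _ [B mB <-]] <-].
rewrite setTI setTI; rewrite -[X in measurable X]setTI.
exact: (mf i measurableT B mB).
Qed.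

Definition dprod_update i (p : dprod * X i) : dprod := dfwith p.1 i p.2.

Lemma measurable_dprod_update i :
  measurable_fun [set: dprod * X i] (@dprod_update i).
Proof.
apply: measurable_dprod => j; have [<-|ij] := eqVneq i j.
  rewrite (_ : (fun _ => _) = snd) //.
  by apply/funext => p; rewrite /dprod_update dfwithin.
rewrite (_ : (fun _ => _) = (fun s : dprod => s j) \o fst).
  by apply: measurableT_comp => //; exact: measurable_dprod_proj.
by apply/funext => p; rewrite /dprod_update dfwithout.
Qed.

HB.instance Definition _ i :=
  isMeasurableFun.Build _ _ _ _ (@dprod_update i) (@measurable_dprod_update i).

Context (R : realType).

(* Start from any profile and redraw each coordinate i once, independently,
   from mu i. *)
Definition dprod_probability (mu : forall i, probability (X i) R) :
    probability dprod R :=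
  foldr (fun i (acc : probability dprod R) =>
           distribution (acc \x mu i)%E (@dprod_update i))
        (\d_point : probability dprod R) (enum 'I_n).

End dependent_product.

Section experiments.
Context (R : realType) (X : pointedFinType).

Record experiment (p : belief R X) := Experiment {
  posterior_law :> probability (belief R X) R;
  _ : forall x, (\int[posterior_law]_s (s x)%:E = (p x)%:E)%E }.

(* tau >=_MPS lam: a coupling pi of (sigma, s) with E[sigma | s] = s, the
   conditional expectation being tested on the events generated by s. *)
Definition mps (tau lam : probability (belief R X) R) : Prop :=
  exists pi : probability (belief R X * belief R X)%type R,
  [/\ forall A : set (belief R X), measurable A -> pi (fst @^-1` A) = tau A,
      forall A : set (belief R X), measurable A -> pi (snd @^-1` A) = lam A &
      forall (x : X) (A : set (belief R X)), measurable A ->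
        (\int[pi]_(p in snd @^-1` A) (p.1 x)%:E =
         \int[pi]_(p in snd @^-1` A) (p.2 x)%:E)%E].

End experiments.

Section conditional_independence.
Context d (Omega : measurableType d) (R : realType) (P : probability Omega R).

(* f \o Z is a version of the conditional probability Pr(E | Z). *)
Definition cond_prob d' (C : measurableType d') (Z : Omega -> C)
    (E : set Omega) (f : C -> R) : Prop :=
  [/\ measurable_fun [set: C] f,
      P.-integrable [set: Omega] (EFin \o (f \o Z)) &
      forall A : set C, measurable A ->
        P (E `&` Z @^-1` A) = (\int[P]_(w in Z @^-1` A) (f (Z w))%:E)%E].

(* X _|_ Y | Z, for X with values in a finite set. *)
Definition cond_indep (F : finType) d1 (D : measurableType d1)
    d2 (C : measurableType d2)
    (X : Omega -> F) (Y : Omega -> D) (Z : Omega -> C) : Prop :=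
  forall (x : F) (B : set D) (f h : C -> R), measurable B ->
    cond_prob Z (X @^-1` [set x]) f -> cond_prob Z (Y @^-1` B) h ->
    cond_prob Z (X @^-1` [set x] `&` Y @^-1` B) (fun c => f c * h c).

End conditional_independence.

Section information.
Context (R : realType) (n : nat) (Theta : 'I_n -> pointedFinType).

Definition state_profile := {dffun forall i, Theta i}.

Definition signal_profile :=
  dprod (fun i => belief R (Theta i) : measurableType _).

Section prior.
Context (g : belief R state_profile).

Definition marginal_weight i : {ffun Theta i -> R} :=
  [ffun x => \sum_(th : state_profile | th i == x) g th].

Fact marginal_weightP i :
  [forall x, 0 <= marginal_weight i x] && (\sum_x marginal_weight i x == 1).
Proof.
apply/andP; split.
  by apply/forallP => x; rewrite ffunE sumr_ge0 // => th _; exact: belief_ge0.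
under eq_bigr do rewrite ffunE.
by rewrite -(belief_sum g) (partition_big (fun th : state_profile => th i) xpredT).
Qed.

Definition marginal i : belief R (Theta i) := Belief (marginal_weightP i).

(* Density, with respect to the product of the laws of the individual
   signals, of "state profile th and signal profile s".  When
   marginal i (th i) = 0 also g th = 0, so the convention y / 0 = 0 is
   harmless. *)
Definition state_density (th : state_profile) (s : signal_profile) : R :=
  g th * \prod_i (s i (th i) / marginal i (th i)).

Definition signal_density (s : signal_profile) : R :=
  \sum_(th : state_profile) state_density th s.

Fact signal_density_ge0 s : 0 <= signal_density s.
Proof.
apply: sumr_ge0 => th _; rewrite mulr_ge0 ?belief_ge0 //.
by apply: prodr_ge0 => i _; rewrite divr_ge0 ?belief_ge0.
Qed.

Fact measurable_signal_density :
  measurable_fun [set: signal_profile] signal_density.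
Proof.
apply: measurable_sum => th; apply: measurable_funM => //.
apply: measurable_prod => i _; apply: measurable_funM => //.
apply: (@measurableT_comp _ _ _ _ _ _ (fun s : belief R (Theta i) => s (th i))).
  exact: measurable_belief_ev.
exact: (measurable_dprod_proj (X := fun i => belief R (Theta i) : measurableType _)).
Qed.

Context (lam : forall i, probability (belief R (Theta i)) R).

(* The joint law of the signals:
   lam(ds) = \sum_th g(th) \prod_i s_i(th_i) lam_i(ds_i) / g_i(th_i). *)
Definition joint_law (A : set signal_profile) : \bar R :=
  (\int[dprod_probability lam]_(s in A) (signal_density s)%:E)%E.

Let joint_law0 : joint_law set0 = 0%E.
Proof. exact: integral_set0. Qed.

Let joint_law_ge0 A : (0 <= joint_law A)%E.
Proof. by apply: integral_ge0 => s _; rewrite lee_fin signal_density_ge0. Qed.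

Let joint_law_sigma_additive : semi_sigma_additive joint_law.
Proof.
apply: semi_sigma_additive_nng_induced.
  by apply/measurable_EFinP; exact: measurable_signal_density.
by move=> s; rewrite lee_fin signal_density_ge0.
Qed.

HB.instance Definition _ := isMeasure.Build _ _ _ joint_law
  joint_law0 joint_law_ge0 joint_law_sigma_additive.

End prior.

(* Types are independent across bidders and independent of states and
   signals; states follow the prior; given the states, signals are
   independent across bidders and Pr(theta_i | sigma_i) = sigma_i(theta_i). *)
Definition environment_law d (Omega : measurableType d)
    (P : probability Omega R)
    (dT : 'I_n -> measure_display) (T : forall i, measurableType (dT i))
    (h : forall i, probability (T i) R)
    (g : belief R state_profile)
    (tau : forall i, experiment (marginal g i))
    (type : {mfun Omega >-> dprod T})
    (state : Omega -> state_profile)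
    (signal : {mfun Omega >-> signal_profile}) : Prop :=
  (forall th, measurable (state @^-1` [set th])) /\
  forall (B : set (dprod T)) (th : state_profile) (A : set signal_profile),
    measurable B -> measurable A ->
    P (type @^-1` B `&` state @^-1` [set th] `&` signal @^-1` A) =
    (dprod_probability h B *
     \int[dprod_probability tau]_(s in A) (state_density g th s)%:E)%E.

End information.

Section mechanisms.
Context (R : realType) (n : nat) (T : 'I_n -> Type)
  (Theta : 'I_n -> pointedFinType) (v : forall i, T i -> Theta i -> R).

Local Notation signals := (signal_profile R Theta).

(* Under information regulation the belief on theta_i given the whole signal
   profile is the signal s_i itself. *)
Definition expected_value i (t : T i) (s : belief R (Theta i)) : R :=
  \sum_x s x * v t x.

Record mechanism := Mechanism {
  alloc : (forall i, T i) -> signals -> 'I_n -> R;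
  payment : (forall i, T i) -> signals -> 'I_n -> R }.

Section properties.
Context (M : mechanism).

(* Under information regulation, E_{s_-i ~ lam_-i} E_{s_i ~ lam_i}: the outer
   integral runs over the joint law, but its i-th coordinate is overwritten,
   so only the marginal on s_-i matters; s_i is drawn from lam_i
   unconditionally. *)
Definition regulated_utility (g : belief R (state_profile Theta))
    i (t : T i) (b : forall j, T j)
    (lam : forall j, experiment (marginal g j)) : \bar R :=
  (\int[joint_law g lam]_s \int[lam i]_si
    let s' : signals := dfwith s i si in
    (alloc M b s' i * expected_value t (s' i) - payment M b s' i)%:E)%E.

Definition dominant_strategy_IIC (g : belief R (state_profile Theta))
    (tau : forall j, experiment (marginal g j)) : Prop :=
  forall (i : 'I_n) (t : T i) (b : forall j, T j)
    (lam : forall j, experiment (marginal g j)),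
    (forall j, mps (tau j) (lam j)) ->
    (regulated_utility t b lam <=
     regulated_utility t (dfwith b i t) (dfwith lam i (tau i)))%E.

Definition individually_rational : Prop :=
  forall (i : 'I_n) (t : forall j, T j) (sigma : signals),
    0 <= alloc M t sigma i * expected_value (t i) (sigma i)
         - payment M t sigma i.

(* Meaningful when P is nonempty. *)
Definition max_over (P : pred 'I_n) (w : 'I_n -> R) : R :=
  fine (\big[maxe/-oo%E]_(j | P j) (w j)%:E).

Definition maximizes_welfare : Prop :=
  forall (t : forall j, T j) (sigma : signals),
    exists i : 'I_n,
      [/\ alloc M t sigma i = 1,
          forall j, j != i -> alloc M t sigma j = 0 &
          expected_value (t i) (sigma i) =
          max_over xpredT (fun j => expected_value (t j) (sigma j))].

End properties.

(* Ties are broken by [tie], a fixed selection from the set of tied bidders. *)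
Definition winner (tie : {set 'I_n} -> 'I_n) (b : forall i, T i) (s : signals)
    : 'I_n :=
  tie [set i | [forall j, expected_value (b j) (s j)
                          <= expected_value (b i) (s i)]]%SET.

Definition expected_vickrey (tie : {set 'I_n} -> 'I_n) : mechanism :=
  Mechanism
    (fun b s i => (i == winner tie b s)%:R)
    (fun b s i => if i == winner tie b s
                  then max_over (predC1 i) (fun j => expected_value (b j) (s j))
                  else 0).

End mechanisms.

(* Main.v *)
Require Import Defs.
From mathcomp Require Import all_boot all_order all_algebra.
From mathcomp Require Import all_classical all_reals all_analysis.
From mathcomp Require Import measurable_realfun.

Set Implicit Arguments.
Unset Strict Implicit.
Unset Printing Implicit Defensive.
Import Order.TTheory GRing.Theory Num.Theory.
Local Open Scope classical_set_scope.
Local Open Scope ring_scope.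

(* Fix the signals of the rivals of bidder i. His highest rival value r does not
   depend on him, so truthful reporting with signal s_i yields
   max 0 (v_i(t_i; s_i) - r), and no report yields more. This payoff is convex in
   s_i, hence by Jensen's inequality its expectation is largest under the most
   informative experiment tau_i. Finally, the law of the rivals' signals does not
   depend on the experiment of bidder i, whose mean is fixed by the prior. *)

(** * Integral comparison and Jensen's inequality for beliefs *)

(** The positive part of [f] lies below [F], and integrals of nonnegative functions are suprema over
    simple functions below them. This covers payoffs at arbitrary reports, whose measurability is
    not established. *)
Lemma le_integral_nneg d (S : measurableType d) (R : realType)
    (mu : measure S R) (f F : S -> \bar R) :
  (forall x, 0 <= F x)%E -> (forall x, f x <= F x)%E ->
  (\int[mu]_x f x <= \int[mu]_x F x)%E.
Proof.
move=> F0 fF; rewrite integralE.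
apply: (@le_trans _ _ (\int[mu]_x f^\+ x)%E).
  by rewrite -[leRHS]sube0 leeB// integral_ge0.
rewrite !ge0_integralTE//; apply: ge_ereal_sup => _ [h hf <-].
apply: ereal_sup_ubound; exists h => // x.
by rewrite (le_trans (hf x))// funeposE ge_max fF F0.
Qed.

Section linear_functional.
Context (R : realType) (X : pointedFinType) (c : X -> R).

Lemma measurable_linear_belief :
  measurable_fun setT (fun s : belief R X => \sum_x s x * c x).
Proof.
apply: measurable_sum => x; apply: measurable_funM => //.
exact: measurable_belief_ev.
Qed.

(** Belief weights lie between 0 and 1, hence are integrable, and linearity applies. *)
Lemma integral_linear_belief d (S : measurableType d)
    (P : probability S R) (D : set S) (s : S -> belief R X) :
  measurable D -> measurable_fun setT s ->
  (\int[P]_(w in D) (\sum_x s w x * c x)%:E =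
   \sum_x (c x)%:E * \int[P]_(w in D) (s w x)%:E)%E.
Proof.
move=> mD ms.
have mev x : measurable_fun setT (fun w => s w x).
  exact: measurableT_comp (measurable_belief_ev x) ms.
have iev x : P.-integrable D (EFin \o (fun w => s w x)).
  apply: measurable_bounded_integrable => //.
  - by apply: le_lt_trans (probability_le1 P mD) _; exact: ltry.
  - exact: measurable_funTS.
  - exists 1; split => // M M1 w _ /=.
    rewrite ger0_norm ?belief_ge0// (le_trans _ (ltW M1))//.
    rewrite -(belief_sum (s w)) (bigD1 x)//= lerDl sumr_ge0// => y _.
    exact: belief_ge0.
under eq_integral.
  move=> w _; rewrite -sumEFin.
  under eq_bigr do rewrite mulrC EFinM.
  over.
rewrite integral_sum//; last by move=> x; exact: (integrableZl mD _ (iev x)).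
by apply: eq_bigr => x _; rewrite (integralZl mD (iev x)).
Qed.

(* Conditional Jensen for the convex function [max 0 \o l], [l] linear: on
   [A = {l > 0}] the value of [l] at [s] equals the average of [l] at [sigma]. *)
Lemma mps_le_integral_max0 (tau lam : probability (belief R X) R) :
  mps tau lam ->
  (\int[lam]_s (Num.max 0 (\sum_x s x * c x))%:E <=
   \int[tau]_s (Num.max 0 (\sum_x s x * c x))%:E)%E.
Proof.
move=> [pi [pi1 pi2 pi12]].
set l := fun s : belief R X => \sum_x s x * c x.
set F := fun s : belief R X => (Num.max 0 (l s))%:E.
have ml : measurable_fun setT l := measurable_linear_belief.
have mF : measurable_fun setT F.
  by apply/measurable_EFinP; exact: measurable_maxr.
have F0 s : (0 <= F s)%E by rewrite lee_fin le_max lexx.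
have marg (f : belief R X * belief R X -> belief R X)
    (mf : measurable_fun setT f) (m : probability (belief R X) R) :
    (forall A, measurable A -> pi (f @^-1` A) = m A) ->
    (\int[m]_s F s = \int[pi]_p F (f p))%E.
  move=> fm.
  rewrite -[RHS](@ge0_integral_pushforward _ _ _ _ _ f mf pi setT F)//.
  by apply: eq_measure_integral => A mA _; apply/esym/fm.
rewrite -/F (marg fst _ tau)// (marg snd _ lam)//.
pose A := [set s | 0 < l s].
have mA : measurable A.
  rewrite (_ : A = setT `&` l @^-1` `]0, +oo[); first exact: ml.
  by rewrite setTI; apply/seteqP; split => s /=; rewrite in_itv/= andbT.
have mA2 : measurable (snd @^-1` A : set (belief R X * belief R X)).
  by rewrite -[X in measurable X]setTI; exact: measurable_snd.
have -> : (\int[pi]_p F p.2 = \int[pi]_(p in snd @^-1` A) (l p.2)%:E)%E.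
  rewrite [RHS]integral_mkcond; apply: eq_integral => p _.
  rewrite /F patchE; case: ifPn => [/set_mem|]; rewrite ?notin_setE /A /= => lp.
    by rewrite max_r// ltW.
  by rewrite max_l// leNgt; apply/negP.
(* The coupling identity is stated for each coordinate: expand [l], trade [s] for [sigma] coordinate
   by coordinate on the event [A] of [s], and reassemble. *)
rewrite integral_linear_belief//.
under eq_bigr do rewrite -pi12//.
rewrite -integral_linear_belief// integral_mkcond.
apply: le_integral_nneg => // p.
rewrite patchE; case: ifP => _ //.
by rewrite lee_fin le_max lexx orbT.
Qed.

End linear_functional.

(** The witness [j0] keeps the extended maximum away from [-oo], so [fine] returns its true
    value. *)
Lemma max_overP (R : realType) n (P : pred 'I_n) (w : 'I_n -> R) j0 : P j0 ->
  (exists2 j, P j & max_over P w = w j) /\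
  (forall j, P j -> w j <= max_over P w).
Proof.
move=> Pj0; case: (@arg_maxP _ _ _ j0 P w Pj0) => j Pj jmax.
have -> : max_over P w = w j.
  rewrite /max_over (_ : \big[maxe/-oo%E]_(k | P k) (w k)%:E = (w j)%:E)//.
  apply/eqP; rewrite eq_le; apply/andP; split.
    by apply/bigmax_leP; split; [rewrite leNye|move=> k Pk; rewrite lee_fin; exact: jmax].
  exact: (le_bigmax_cond _ (fun k => (w k)%:E)).
by split; [exists j|].
Qed.

(** * Product laws as successive redraws of single coordinates *)

Section redraw.
Context (R : realType) (n : nat) (d : 'I_n -> measure_display)
  (X : forall i, measurableType (d i)).
Implicit Types (mu : forall i, probability (X i) R) (f : dprod X -> \bar R).

Lemma dfwith_dfwith i (s : dprod X) x y :
  dfwith (dfwith s i x) i y = dfwith s i y.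
Proof.
apply/functional_extensionality_dep => j; have [<-|ij] := eqVneq i j.
  by rewrite !dfwithin.
by rewrite !dfwithout.
Qed.

Lemma dfwithC i j (s : dprod X) x y : i != j ->
  dfwith (dfwith s i x) j y = dfwith (dfwith s j y) i x.
Proof.
move=> ij; apply/functional_extensionality_dep => k.
have [ik|ik] := eqVneq i k; have [jk|jk] := eqVneq j k.
- by case/eqP: ij; exact: etrans ik (esym jk).
- by subst k; rewrite dfwithin dfwithout// dfwithin.
- by subst k; rewrite dfwithin dfwithout// dfwithin.
- by rewrite !dfwithout.
Qed.

(** The action on integrands of one step of [dprod_probability]. *)
Definition redraw i (m : probability (X i) R) f (s : dprod X) : \bar R :=
  (\int[m]_x f (dfwith s i x))%E.

Lemma measurable_dfwith i : measurable_fun setT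
  (fun p : dprod X * X i => dfwith p.1 i p.2 : dprod X).
Proof. exact: measurable_dprod_update. Qed.

Lemma redraw_ge0 i m f : (forall s, 0 <= f s)%E ->
  forall s, (0 <= @redraw i m f s)%E.
Proof. by move=> f0 s; exact: integral_ge0. Qed.

Lemma measurable_redraw i m f :
  (forall s, 0 <= f s)%E -> measurable_fun setT f ->
  measurable_fun setT (@redraw i m f).
Proof.
move=> f0 mf.
refine (@measurable_fun_fubini_tonelli_F _ _ (dprod X) (X i) R m
  (fun p => f (dfwith p.1 i p.2)) _ _) => //.
exact: measurableT_comp mf (@measurable_dfwith i).
Qed.

(** Tonelli's theorem, since updates of distinct coordinates commute. *)
Lemma redrawC i j mi mj f : i != j ->
  (forall s, 0 <= f s)%E -> measurable_fun setT f ->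
  @redraw i mi (@redraw j mj f) = @redraw j mj (@redraw i mi f).
Proof.
move=> ij f0 mf; apply/funext => s; rewrite /redraw.
transitivity (\int[mj]_y \int[mi]_x f (dfwith (dfwith s i x) j y))%E; last first.
  apply: eq_integral => y _; apply: eq_integral => x _.
  by rewrite (dfwithC s x y ij).
apply: (fubini_tonelli (m1 := mi) (m2 := mj)
  (fun p => f (dfwith (dfwith s i p.1) j p.2))) => [|p]; last exact: f0.
apply: measurableT_comp mf _.
apply: (@measurableT_comp _ _ _ _ _ _
  (fun p : dprod X * X j => dfwith p.1 j p.2 : dprod X)
  _ (fun p : X i * X j => (dfwith s i p.1 : dprod X, p.2))).
  exact: measurable_dfwith.
apply: measurable_fun_pair => //.
apply: (@measurableT_comp _ _ _ _ _ _
  (fun p : dprod X * X i => dfwith p.1 i p.2 : dprod X)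
  _ (fun p : X i * X j => (s, p.1))).
  exact: measurable_dfwith.
exact: measurable_fun_pair.
Qed.

Lemma integral_redraw (acc : probability (dprod X) R) i (m : probability (X i) R) f :
  (forall s, 0 <= f s)%E -> measurable_fun setT f ->
  (\int[distribution (acc \x m)%E (@dprod_update n d X i)]_s f s =
   \int[acc]_s redraw m f s)%E.
Proof.
move=> f0 mf; rewrite ge0_integral_distribution//.
rewrite fubini_tonelli1//; last by move=> p; exact: f0.
exact: measurableT_comp mf (@measurable_dprod_update _ _ _ i).
Qed.

(** The fold of [dprod_probability] over an arbitrary list, to allow induction. *)
Definition redraw_all mu (l : seq 'I_n) : probability (dprod X) R :=
  foldr (fun i (acc : probability (dprod X) R) =>
           distribution (acc \x mu i)%E (@dprod_update n d X i))
        (\d_point : probability (dprod X) R) l.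

Lemma integral_redraw_all_cons mu j l f :
  (forall s, 0 <= f s)%E -> measurable_fun setT f ->
  (\int[redraw_all mu (j :: l)]_s f s =
   \int[redraw_all mu l]_s redraw (mu j) f s)%E.
Proof. exact: integral_redraw. Qed.

Lemma eq_integral_redraw_all mu nu (l : seq 'I_n) f :
  {in l, forall j, mu j = nu j} ->
  (forall s, 0 <= f s)%E -> measurable_fun setT f ->
  (\int[redraw_all mu l]_s f s = \int[redraw_all nu l]_s f s)%E.
Proof.
elim: l f => [|j l IH] f munu f0 mf; first by [].
apply: etrans (integral_redraw_all_cons mu j l f0 mf) _.
apply: etrans (esym (integral_redraw_all_cons nu j l f0 mf)).
rewrite (munu j (mem_head _ _)); apply: IH.
- by move=> k kl; apply: munu; rewrite inE kl orbT.
- exact: redraw_ge0.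
- exact: measurable_redraw.
Qed.

(* Since redraws of distinct coordinates commute, an agreement of [f] under the
   redraw of coordinate [i] survives the redraws made before reaching [i]. *)
Lemma eq_integral_dprod_probability i mu nu f :
  (forall j, j != i -> mu j = nu j) ->
  (forall s, 0 <= f s)%E -> measurable_fun setT f ->
  redraw (mu i) f = redraw (nu i) f ->
  (\int[dprod_probability mu]_s f s = \int[dprod_probability nu]_s f s)%E.
Proof.
move=> munu; rewrite -[dprod_probability mu]/(redraw_all mu (enum 'I_n)).
rewrite -[dprod_probability nu]/(redraw_all nu (enum 'I_n)).
have := mem_enum 'I_n i; have := enum_uniq 'I_n; move: (enum 'I_n) => l.
rewrite inE; elim: l f => [|j l IH] f; first by rewrite in_nil.
rewrite cons_uniq inE => /andP[jl ul] il f0 mf fE.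
apply: etrans (integral_redraw_all_cons mu j l f0 mf) _.
apply: etrans (esym (integral_redraw_all_cons nu j l f0 mf)).
have [ji|ji] := eqVneq j i.
  (* The list has no repetition, so its tail avoids [i] and the two families agree on it. *)
  subst j; rewrite fE; apply: eq_integral_redraw_all.
  - by move=> k kl; apply: munu; apply: contraNneq jl => <-.
  - exact: redraw_ge0.
  - exact: measurable_redraw.
rewrite (munu j ji); apply: IH.
- exact: ul.
- by move: il; rewrite eq_sym (negbTE ji).
- exact: redraw_ge0.
- exact: measurable_redraw.
- have ij : i != j by rewrite eq_sym.
  by rewrite (redrawC _ _ ij f0 mf) fE (redrawC _ _ ij f0 mf).
Qed.

End redraw.

(** * The law of the rivals' signals *)

Section marginal_of_joint_law.
Context (R : realType) (n : nat) (Theta : 'I_n -> pointedFinType)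
  (g : belief R (state_profile Theta)).
Local Notation signals := (signal_profile R Theta).

(** The signal of [i] enters each summand through the single factor [x (th i)]; grouping state
    profiles by their [i]-th state collects the rest into [c]. *)
Lemma signal_density_linear (i : 'I_n) (s : signals) :
  exists c : Theta i -> R, forall x : belief R (Theta i),
    signal_density g (dfwith s i x) = \sum_y x y * c y.
Proof.
exists (fun y => \sum_(th : state_profile Theta | th i == y)
  g th / marginal g i (th i) *
    \prod_(j | j != i) (s j (th j) / marginal g j (th j))) => x.
rewrite /signal_density (partition_big (fun th : state_profile Theta => th i) xpredT)//=.
apply: eq_bigr => y _; rewrite big_distrr/=; apply: eq_bigr => th /eqP <-.
rewrite /state_density (bigD1 i)//= dfwithin.
rewrite (eq_bigr (fun j => s j (th j) / marginal g j (th j))).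
  by rewrite !mulrA; congr (_ * _); rewrite mulrAC (mulrC (x _)) mulrAC.
by move=> j ji; rewrite dfwithout// eq_sym.
Qed.

Lemma integral_experiment_linear (X : pointedFinType) (p : belief R X)
    (m : experiment p) (c : X -> R) :
  (\int[m]_s (\sum_x s x * c x)%:E = (\sum_x c x * p x)%:E)%E.
Proof.
rewrite (integral_linear_belief c m measurableT (@measurable_id _ _ setT)).
case: m => m mp /=; rewrite -sumEFin; apply: eq_bigr => x _.
by rewrite mp EFinM.
Qed.

(* The law of [s_-i] does not depend on the experiment of bidder [i]: the joint
   density is linear in [s_i], whose mean is the prior. *)
Lemma eq_integral_joint_law (i : 'I_n)
    (lam nu : forall j, experiment (marginal g j)) (G : signals -> \bar R) :
  (forall j, j != i -> lam j = nu j) ->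
  (forall s, 0 <= G s)%E -> measurable_fun setT G ->
  (forall s x, G (dfwith s i x) = G s) ->
  (\int[joint_law g lam]_s G s = \int[joint_law g nu]_s G s)%E.
Proof.
move=> lamnu G0 mG Gi.
(* As [G] ignores coordinate [i], that coordinate may be set to a default; it then suffices to
   compare the laws on events that ignore it. *)
pose forget (s : signals) : signals := dfwith s i point.
have mforget : measurable_fun setT forget.
  apply: (@measurableT_comp _ _ _ _ _ _
    (fun p : signals * belief R (Theta i) => dfwith p.1 i p.2 : signals)
    _ (fun s : signals => (s, point : belief R (Theta i)))).
    exact: (@measurable_dprod_update _ _ (fun j => belief R (Theta j))).
  exact: measurable_fun_pair.
have push (kap : forall j, experiment (marginal g j)) :
    (\int[joint_law g kap]_s G s =
     \int[pushforward (joint_law g kap) forget]_s G s)%E.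
  rewrite (ge0_integral_pushforward mforget)//.
  by apply: eq_integral => s _; rewrite /= Gi.
refine (etrans (push lam) (etrans _ (esym (push nu)))).
apply: eq_measure_integral => A mA _.
change (joint_law g lam (forget @^-1` A) = joint_law g nu (forget @^-1` A)).
rewrite /joint_law.
rewrite [LHS]integral_mkcond [RHS]integral_mkcond.
have mB : measurable (forget @^-1` A).
  by rewrite -[X in measurable X]setTI; exact: mforget.
apply: (@eq_integral_dprod_probability _ _ _ _ i).
- by move=> j ji; rewrite lamnu.
- by move=> s; rewrite patchE; case: ifP => // _; rewrite lee_fin signal_density_ge0.
- apply/(measurable_restrictT _ mB); apply: measurable_funTS.
  by apply/measurable_EFinP; exact: measurable_signal_density.
apply/funext => s; have [c cE] := signal_density_linear i s.
have inB x : (dfwith s i x \in forget @^-1` A) = (s \in forget @^-1` A).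
  by apply/idP/idP; rewrite !inE /= /forget dfwith_dfwith.
(* Redrawing [s_i] averages either zero or a linear function of [s_i], and the latter average sees
   only the mean of [m], which is the prior marginal. *)
suff redrawE (m : experiment (marginal g i)) :
    redraw m ((fun s => (signal_density g s)%:E) \_ (forget @^-1` A)) s =
    if s \in forget @^-1` A then (\sum_y c y * marginal g i y)%:E else 0%E.
  by apply: etrans (redrawE (lam i)) (esym (redrawE (nu i))).
rewrite -(integral_experiment_linear m) /redraw.
case: ifPn => sB; last first.
  by apply: integral0_eq => x _; rewrite patchE inB (negbTE sB).
by apply: eq_integral => x _; rewrite patchE inB sB cE.
Qed.

End marginal_of_joint_law.

Lemma measurable_max_over d (S : measurableType d) (R : realType) n
    (P : pred 'I_n) (w : 'I_n -> S -> R) :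
  (forall j, measurable_fun setT (w j)) ->
  measurable_fun setT (fun s => max_over P (w ^~ s)).
Proof.
move=> mw; rewrite /max_over.
apply: (@measurableT_comp _ _ _ _ _ _ (@fine R)); first exact: fine_measurable.
elim: (index_enum _) => [|j l IH].
  by under eq_fun do rewrite big_nil; exact: measurable_cst.
under eq_fun do rewrite big_cons.
case: (P j) => //; apply: measurable_maxe => //.
exact/measurable_EFinP.
Qed.

(** * Payoffs and incentives in the auction *)

Section vickrey.
Context (R : realType) (n : nat) (n_gt1 : (1 < n)%N) (T : 'I_n -> Type)
  (Theta : 'I_n -> pointedFinType) (v : forall i, T i -> Theta i -> R)
  (tie : {set 'I_n} -> 'I_n)
  (tieP : forall A : {set 'I_n}, A != finset.set0 -> tie A \in A).
Local Notation signals := (signal_profile R Theta).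
Implicit Types (b : forall j, T j) (s : signals) (i : 'I_n).

Definition rival_value b s i : R :=
  max_over (predC1 i) (fun j => expected_value v (b j) (s j)).

Lemma winner_max b s j :
  expected_value v (b j) (s j) <=
  expected_value v (b (winner v tie b s)) (s (winner v tie b s)).
Proof.
pose w k := expected_value v (b k) (s k).
have : winner v tie b s \in [set k | [forall l, w l <= w k]]%SET.
  apply: tieP; apply/finset.set0Pn.
  case: (@arg_maxP _ _ _ j xpredT w isT) => k _ kmax.
  by exists k; rewrite finset.inE; apply/forallP => l; exact: kmax.
by rewrite finset.inE => /forallP/(_ j).
Qed.

(** Since [1 < n], every bidder has a rival, so the maximum is over a nonempty set. *)
Lemma rival_valueP b s i :
  (exists2 j, j != i & rival_value b s i = expected_value v (b j) (s j)) /\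
  (forall j, j != i -> expected_value v (b j) (s j) <= rival_value b s i).
Proof.
have [j ji] : exists j, predC1 i j.
  by apply/card_gt0P; rewrite cardC1 card_ord -subn1 subn_gt0.
exact: max_overP ji.
Qed.

(** A winner's value is at least that of the best rival; a loser's is at most the winner's, who is
    one of his rivals. *)
Lemma vickrey_payoff_truthful b s i :
  alloc (expected_vickrey v tie) b s i * expected_value v (b i) (s i)
    - payment (expected_vickrey v tie) b s i =
  Num.max 0 (expected_value v (b i) (s i) - rival_value b s i).
Proof.
have [[j ji jE] rmax] := rival_valueP b s i; rewrite /=.
case: eqP => [iw|/eqP iw].
  have := winner_max b s j; rewrite -iw => wj.
  by rewrite mul1r max_r// subr_ge0 jE.
rewrite mul0r subr0 max_l// subr_le0.
by rewrite (le_trans (winner_max b s i))// rmax// eq_sym.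
Qed.

Lemma rival_value_dfwith b s i (t : T i) (x : belief R (Theta i)) :
  rival_value (dfwith b i t) (dfwith s i x) i = rival_value b s i.
Proof.
rewrite /rival_value /max_over; congr (fine _).
by apply: eq_bigr => j ji; rewrite !dfwithout// eq_sym.
Qed.

Lemma vickrey_payoff_dfwith_truthful b s i (t : T i) (x : belief R (Theta i)) :
  let s' : signals := dfwith s i x in
  alloc (expected_vickrey v tie) (dfwith b i t) s' i * expected_value v t (s' i)
    - payment (expected_vickrey v tie) (dfwith b i t) s' i =
  Num.max 0 (expected_value v t x - rival_value b s i).
Proof.
have := vickrey_payoff_truthful (dfwith b i t) (dfwith s i x) i.
by rewrite rival_value_dfwith !dfwithin => <- s'; rewrite /s' dfwithin.
Qed.

(** The report only decides between winning at the price set by the rivals and getting 0. *)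
Lemma vickrey_payoff_dfwith_le b s i (t : T i) (x : belief R (Theta i)) :
  let s' : signals := dfwith s i x in
  alloc (expected_vickrey v tie) b s' i * expected_value v t (s' i)
    - payment (expected_vickrey v tie) b s' i <=
  Num.max 0 (expected_value v t x - rival_value b s i).
Proof.
have -> : rival_value b s i = rival_value b (dfwith s i x) i.
  (* [rival_value_dfwith] overwrites report and signal together, so [t] is inserted and then removed
     again. *)
  rewrite -(rival_value_dfwith b (dfwith s i x) t x) dfwith_dfwith.
  by rewrite rival_value_dfwith.
rewrite /= dfwithin; case: ifP => _; first by rewrite mul1r le_max lexx orbT.
by rewrite mul0r subr0 le_max lexx.
Qed.

Lemma vickrey_IR : individually_rational v (expected_vickrey v tie).
Proof. by move=> i t sigma; rewrite vickrey_payoff_truthful le_max lexx. Qed.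

Lemma vickrey_maximizes_welfare :
  maximizes_welfare v (expected_vickrey v tie).
Proof.
move=> t sigma; exists (winner v tie t sigma); split => /=.
- by rewrite eqxx.
- by move=> j /negbTE ->.
- pose w j := expected_value v (t j) (sigma j).
  have [[j _ jE] wmax] := @max_overP R n xpredT w (winner v tie t sigma) isT.
  by apply/eqP; rewrite eq_le wmax//= jE winner_max.
Qed.

(* [max 0 (v_i(t; s_i) - r)] is [max 0] of a linear functional of [s_i], because
   beliefs sum to one; this makes Jensen applicable. *)
Lemma expected_value_sub i (t : T i) (x : belief R (Theta i)) (r : R) :
  expected_value v t x - r = \sum_y x y * (v t y - r).
Proof.
under [RHS]eq_bigr do rewrite mulrBr.
by rewrite sumrB -mulr_suml belief_sum mul1r.
Qed.

Lemma vickrey_IIC (g : belief R (state_profile Theta))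
    (tau : forall j, experiment (marginal g j)) :
  dominant_strategy_IIC v (expected_vickrey v tie) tau.
Proof.
move=> i t b lam mpslam; rewrite /regulated_utility.
pose payoff s (x : belief R (Theta i)) : \bar R :=
  (Num.max 0 (expected_value v t x - rival_value b s i))%:E.
have payoff0 s x : (0 <= payoff s x)%E by rewrite lee_fin le_max lexx.
(* The payoff from truth and full revelation given the rivals' signals; it ignores [s i], so its
   integral is the same under both joint laws. *)
pose G s := (\int[tau i]_x payoff s x)%E.
have G0 s : (0 <= G s)%E by exact: integral_ge0.
have mev j (c : T j) :
    measurable_fun setT (fun s : signals => expected_value v c (s j)).
  apply: (@measurableT_comp _ _ _ _ _ _
    (fun x : belief R (Theta j) => expected_value v c x)).
    exact: measurable_linear_belief.
  exact: (measurable_dprod_proj (X := fun i => belief R (Theta i))).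
have mpayoff : measurable_fun setT
    (fun p : signals * belief R (Theta i) => payoff p.1 p.2).
  apply/measurable_EFinP; apply: measurable_maxr => //; apply: measurable_funB.
    apply: (@measurableT_comp _ _ _ _ _ _
      (fun x : belief R (Theta i) => expected_value v t x)) => //.
    exact: measurable_linear_belief.
  apply: (@measurableT_comp _ _ _ _ _ _
    (fun s : signals => rival_value b s i)) => //.
  by apply: measurable_max_over => j; exact: mev.
have mG : measurable_fun setT G.
  exact: (measurable_fun_fubini_tonelli_F (m2 := tau i) _ mpayoff
    (fun p => payoff0 p.1 p.2)).
have GE : (\int[joint_law g lam]_s G s =
           \int[joint_law g (dfwith lam i (tau i))]_s G s)%E.
  apply: (@eq_integral_joint_law _ _ _ _ i) => //.
  - by move=> j ji; rewrite dfwithout// eq_sym.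
  - move=> s x; apply: eq_integral => y _; rewrite /payoff.
    rewrite -(rival_value_dfwith b (dfwith s i x) t y) dfwith_dfwith.
    by rewrite rival_value_dfwith.
have eq_leE (y z : \bar R) : y = z -> (y <= z)%E by move->.
refine (@le_trans _ _ (\int[joint_law g lam]_s G s)%E _ _ _ _); last first.
  refine (le_trans (eq_leE _ _ GE) (eq_leE _ _ _)).
  apply: eq_integral => s _; rewrite dfwithin; apply: eq_integral => x _.
  exact/esym/congr1/vickrey_payoff_dfwith_truthful.
refine (le_integral_nneg _ G0 _) => s.
(* For fixed rivals' signals, first correct the report under [lam i], then pass from [lam i] to
   [tau i] by Jensen. *)
refine (@le_trans _ _ (\int[lam i]_x payoff s x)%E _ _ _ _).
  refine (le_integral_nneg _ (payoff0 s) _) => x.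
  by rewrite lee_fin; exact: vickrey_payoff_dfwith_le.
rewrite /G /payoff.
under eq_integral do rewrite expected_value_sub.
under [leRHS]eq_integral do rewrite expected_value_sub.
exact: mps_le_integral_max0.
Qed.

End vickrey.

Theorem corollary7p4 (R : realType) (n : nat) (n_gt1 : (1 < n)%N)
    (dT : 'I_n -> measure_display) (T : forall i, measurableType (dT i))
    (Theta : 'I_n -> pointedFinType)
    (v : forall i, T i -> Theta i -> R)
    (g : belief R (state_profile Theta))
    (tau : forall i, experiment (marginal g i))
    (h : forall i, probability (T i) R)
    (d : measure_display) (Omega : measurableType d)
    (P : probability Omega R)
    (type : {mfun Omega >-> dprod T})
    (state : Omega -> state_profile Theta)
    (signal : {mfun Omega >-> signal_profile R Theta})
    (env : environment_law P h tau type state signal)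
    (state_indep : forall i j : 'I_n, i != j ->
       cond_indep P (fun w => state w i) (fun w => signal w j)
         (fun w => signal w i))
    (tie : {set 'I_n} -> 'I_n)
    (tieP : forall A : {set 'I_n}, A != finset.set0 -> tie A \in A) :
  [/\ dominant_strategy_IIC v (expected_vickrey v tie) tau,
      individually_rational v (expected_vickrey v tie) &
      maximizes_welfare v (expected_vickrey v tie)].
Proof.
split.
- exact: vickrey_IIC.
- exact: vickrey_IR.
- exact: vickrey_maximizes_welfare.
Qed.
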